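(* If the DAE $\dot q=f(q,u)$, $0=\phi(q,u)$ is an index 1 system (with dynamical variables $q$ and algebraic variables $u$), then the associated adjoint DAE system $$\dot q^i=f^i(q,u),\qquad \dot p_j=-p_i\frac{\partial f^i}{\partial q^j}-\lambda_A\frac{\partial\phi^A}{\partial q^j},\qquad 0=\phi^A(q,u),\qquad 0=p_i\frac{\partial f^i}{\partial u^a}+\lambda_A\frac{\partial\phi^A}{\partial u^a}$$ is an index 1 system with dynamical variables $(q,p)$ and algebraic variables $(u,\lambda)$.
   Context: All maps are smooth. The statement is local, in coordinates $q=(q^i)$ on a manifold $M_d$, $u=(u^a)$ on a manifold $M_a$, where $f(q,u)\in T_qM_d$ and $\phi$ is a section of a vector bundle $\Phi\to M_d\times M_a$ with components $\phi^A$ in a local trivialization; $p=(p_j)$ are coordinates on $T_q^*M_d$ and $\lambda=(\lambda_A)$ coordinates on the fibers of $\Phi^*$. Repeated indices are summed. A semi-explicit DAE $\dot x=F(x,y)$, $0=G(x,y)$ with dynamical variables $x$ and algebraic variables $y$ is said to be of index 1 if the matrix $\partial G/\partial y$ is (square and) invertible at every point where $G(x,y)=0$. *)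

(* Defs.v *)
From HB Require Import structures.
From mathcomp Require Import all_boot all_order all_algebra.
From mathcomp Require Import all_classical all_reals all_analysis.

Set Implicit Arguments.
Unset Strict Implicit.
Unset Printing Implicit Defensive.

Import Order.TTheory GRing.Theory Num.Theory numFieldNormedType.Exports.
Local Open Scope classical_set_scope.
Local Open Scope ring_scope.

(* Meant for U open and V finite-dimensional. *)
Fixpoint C_on (R : realType) (V W : normedModType R) (r : nat) (U : set V)
    (g : V -> W) : Prop :=
  if r is r'.+1 then
    (forall z, U z -> differentiable g z) /\
    (forall v, C_on r' U (fun z => 'D_v g z))
  else forall z, U z -> {for z, continuous g}.

Definition smooth_on (R : realType) (V W : normedModType R) (U : set V)
    (g : V -> W) : Prop :=
  forall r, C_on r U g.

(* 'J g x has entry d(g^i)/d(x^j) in row j and column i; the transposes below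
   restore the usual layout, with row i for g^i and column j for the variable. *)
Definition jac1 (R : realType) (n m k : nat)
    (g : 'rV[R]_n -> 'rV[R]_m -> 'rV[R]_k) (x : 'rV[R]_n) (y : 'rV[R]_m) :
    'M[R]_(k, n) := ('J (fun x' => g x' y) x)^T.

Definition jac2 (R : realType) (n m k : nat)
    (g : 'rV[R]_n -> 'rV[R]_m -> 'rV[R]_k) (x : 'rV[R]_n) (y : 'rV[R]_m) :
    'M[R]_(k, m) := ('J (fun y' => g x y') y)^T.

(* The DAE  x' = F(x, y), 0 = G(x, y)  in local coordinates, with n dynamical
   variables x, m algebraic variables y and k constraints; (x, y) ranges over
   dae_dom, and the values of dae_F and dae_G elsewhere are irrelevant. *)
Record dae (R : realType) (n m k : nat) := DAE {
  dae_dom : set ('rV[R]_n * 'rV[R]_m);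
  dae_F : 'rV[R]_n -> 'rV[R]_m -> 'rV[R]_n;
  dae_G : 'rV[R]_n -> 'rV[R]_m -> 'rV[R]_k
}.

Definition smooth_dae (R : realType) (n m k : nat) (D : dae R n m k) : Prop :=
  [/\ open (dae_dom D),
      smooth_on (dae_dom D) (fun z => dae_F D z.1 z.2) &
      smooth_on (dae_dom D) (fun z => dae_G D z.1 z.2)].

(* Smoothness is part of the notion: all systems are smooth. The equation
   k = m is the squareness of dG/dy. *)
Definition index1 (R : realType) (n m k : nat) (D : dae R n m k) : Prop :=
  smooth_dae D /\
  exists square : k = m, forall x y, dae_dom D (x, y) -> dae_G D x y = 0 ->
    castmx (square, erefl m) (jac2 (dae_G D) x y) \in unitmx.

(* X = (q, p) and Y = (u, lambda) are concatenated row vectors. The momenta p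
   and the multipliers lambda are unrestricted. *)
Definition adjoint_dom (R : realType) (n m k : nat)
    (U : set ('rV[R]_n * 'rV[R]_m)) :
    set ('rV[R]_(n + n) * 'rV[R]_(m + k)) :=
  [set Z | U (lsubmx Z.1, lsubmx Z.2)].

Definition adjoint_F (R : realType) (n m k : nat)
    (f : 'rV[R]_n -> 'rV[R]_m -> 'rV[R]_n)
    (phi : 'rV[R]_n -> 'rV[R]_m -> 'rV[R]_k)
    (X : 'rV[R]_(n + n)) (Y : 'rV[R]_(m + k)) : 'rV[R]_(n + n) :=
  let q := lsubmx X in let p := rsubmx X in
  let u := lsubmx Y in let lambda := rsubmx Y in
  row_mx (f q u)
    (\row_(j < n) (- (\sum_(i < n) p 0 i * jac1 f q u i j)
                   - \sum_(A < k) lambda 0 A * jac1 phi q u A j)).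

Definition adjoint_G (R : realType) (n m k : nat)
    (f : 'rV[R]_n -> 'rV[R]_m -> 'rV[R]_n)
    (phi : 'rV[R]_n -> 'rV[R]_m -> 'rV[R]_k)
    (X : 'rV[R]_(n + n)) (Y : 'rV[R]_(m + k)) : 'rV[R]_(k + m) :=
  let q := lsubmx X in let p := rsubmx X in
  let u := lsubmx Y in let lambda := rsubmx Y in
  row_mx (phi q u)
    (\row_(a < m) (\sum_(i < n) p 0 i * jac2 f q u i a
                   + \sum_(A < k) lambda 0 A * jac2 phi q u A a)).

Definition adjoint_dae (R : realType) (n m k : nat) (D : dae R n m k) :
    dae R (n + n) (m + k) (k + m) :=
  DAE (adjoint_dom (dae_dom D)) (adjoint_F (dae_F D) (dae_G D))
      (adjoint_G (dae_F D) (dae_G D)).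

(* Main.v *)
Require Import Defs.
From HB Require Import structures.
From mathcomp Require Import all_boot all_order all_algebra.
From mathcomp Require Import all_classical all_reals all_analysis.
Import Order.TTheory GRing.Theory Num.Theory numFieldNormedType.Exports.
Local Open Scope classical_set_scope.
Local Open Scope ring_scope.

(* The adjoint constraints (phi, p f_u + lambda phi_u) depend on lambda only
   through the term lambda phi_u, which is linear in it, so their derivative in
   (u, lambda) is the block triangular matrix [[phi_u, 0], [*, phi_u^T]], with
   determinant (det phi_u)^2.  Where the adjoint constraints vanish, phi
   vanishes, so phi_u is invertible there. *)

Set Implicit Arguments.
Unset Strict Implicit.
Unset Printing Implicit Defensive.

(** * Differentials of continuous linear maps *)

Section Continuous_linear.
Context {R : realType} {V W : normedModType R}.
Variables (L : V -> W) (linL : linear L) (contL : continuous L).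

(** Maps such as coordinate projections occur below as plain functions with a proof of linearity;
    packing [L] as a bundled linear map gives access to the results on differentials of linear
    maps. *)
Let LM := GRing.isLinear.Build _ _ _ _ _ linL.
Let LL : {linear V -> W} := HB.pack L LM.

Lemma differentiable_linear z : differentiable L z.
Proof. exact: (@linear_differentiable _ _ _ LL). Qed.

Lemma diff_linear z : 'd L z = L :> (V -> W).
Proof. exact: (@diff_lin _ _ _ LL). Qed.

Lemma derive_linear z v : 'D_v L z = L v.
Proof. by rewrite deriveE ?diff_linear//; exact: differentiable_linear. Qed.

End Continuous_linear.

(** * Closure properties of maps of class C^r *)

Section C_on.
Context {R : realType}.

Lemma derive_comp_linear (V W X : normedModType R) (g : V -> W) (L : W -> X)
    z v : linear L -> continuous L -> differentiable g z ->
  'D_v (fun y => L (g y)) z = L ('D_v g z).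
Proof.
move=> linL contL dg.
have dL := differentiable_linear linL contL (g z).
rewrite (deriveE _ dg) -[fun y => _]/(L \o g) deriveE; last first.
  exact: differentiable_comp.
by rewrite (diff_comp dg dL) /= (diff_linear linL contL).
Qed.

Lemma derive_precomp_linear (V W X : normedModType R) (g : W -> X) (L : V -> W)
    z v : linear L -> continuous L -> differentiable g (L z) ->
  'D_v (fun y => g (L y)) z = 'D_(L v) g (L z).
Proof.
move=> linL contL dg.
have dL := differentiable_linear linL contL z.
rewrite (deriveE _ dg) -[fun y => _]/(g \o L) deriveE; last first.
  exact: differentiable_comp.
by rewrite (diff_comp dL dg) /= (diff_linear linL contL).
Qed.

(** Differentiability is a first-order expansion with a little-o remainder, so it depends only on
    the germ at [z]; the differential of [g] serves for [h]. *)
Lemma near_eq_differentiable (V W : normedModType R) (g h : V -> W) z :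
  (\forall y \near z, g y = h y) -> differentiable g z -> differentiable h z.
Proof.
move=> gh dg.
have [cdg eg] := (diff_locallyP z g).1 dg.
have eh : h \o shift z = cst (h z) + 'd g z +o_ 0 id.
  apply/eqaddoP => e e0.
  have gh0 : \forall y \near (0 : V), g (y + z) = h (y + z).
    by move: gh; rewrite (near_shift 0) subr0.
  move/eqaddoP : eg => /(_ e e0); apply: filterS2 gh0 => y /= gy.
  by rewrite !fctE /= gy (nbhs_singleton gh).
by apply/diff_locallyP; rewrite (diff_unique cdg eh); split.
Qed.

Context {V : normedModType R} (U : set V).

(** Openness turns agreement on [U] into agreement near each of its points, so the directional
    derivatives agree on [U] too and the induction continues. Derivative rules valid only on [U] can
    then be used inside [C_on]. *)
Lemma C_on_ext (W : normedModType R) r (g h : V -> W) : open U ->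
  (forall z, U z -> g z = h z) -> C_on r U g -> C_on r U h.
Proof.
move=> oU; elim: r g h => [|r IH] g h gh /=.
  move=> cg z Uz; have nbU : nbhs z U by exact: open_nbhs_nbhs.
  rewrite /prop_for /continuous_at -(gh _ Uz).
  apply: cvg_trans (cg z Uz).
  by apply: near_eq_cvg; apply: filterS nbU => y Uy; rewrite gh.
move=> [dg Dg]; split => [z Uz|v].
  apply: near_eq_differentiable (dg z Uz).
  by apply: filterS (open_nbhs_nbhs (conj oU Uz)).
apply: IH (Dg v) => z Uz; apply: near_eq_derive.
by apply: filterS (open_nbhs_nbhs (conj oU Uz)).
Qed.

Lemma C_onS (W : normedModType R) r (g : V -> W) : C_on r.+1 U g -> C_on r U g.
Proof.
elim: r g => [|r IH] g [dg Dg].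
  by move=> z Uz; apply: differentiable_continuous; exact: dg.
by split => // v; apply: IH; exact: Dg.
Qed.

Lemma C_on_cst (W : normedModType R) r (c : W) : C_on r U (fun=> c).
Proof.
elim: r c => [|r IH] c; first by move=> z _; exact: cvg_cst.
split => [z _|v]; first exact: differentiable_cst.
rewrite [X in C_on _ _ X](_ : _ = fun=> 0) ?funeqE//.
by move=> z; exact: (derive_cst c).
Qed.

Lemma C_on_linear (W : normedModType R) r (L : V -> W) :
  linear L -> continuous L -> C_on r U L.
Proof.
move=> linL contL; case: r => [|r]; first by move=> z _; exact: contL.
split => [z _|v]; first exact: differentiable_linear.
rewrite [X in C_on _ _ X](_ : _ = fun=> L v); first exact: C_on_cst.
by apply/funext => z; exact: derive_linear.
Qed.

Lemma C_onD (W : normedModType R) r (g h : V -> W) : open U ->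
  C_on r U g -> C_on r U h -> C_on r U (fun z => g z + h z).
Proof.
move=> oU; elim: r g h => [|r IH] g h.
  by move=> cg ch z Uz; apply: cvgD; [exact: cg|exact: ch].
move=> [dg Dg] [dh Dh]; split => [z Uz|v].
  by apply: differentiableD; [exact: dg|exact: dh].
apply: C_on_ext (IH _ _ (Dg v) (Dh v)) => // z Uz.
by rewrite -[RHS]/('D_v (g + h) z) deriveD//; apply: diff_derivable;
  [exact: dg|exact: dh].
Qed.

Lemma C_on_sum (W : normedModType R) r N (g : 'I_N -> V -> W) : open U ->
  (forall i, C_on r U (g i)) -> C_on r U (fun z => \sum_i g i z).
Proof.
move=> oU Cg; elim: N g Cg => [|N IH] g Cg.
  rewrite [X in C_on _ _ X](_ : _ = fun=> 0); first exact: C_on_cst.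
  by apply/funext => z; rewrite big_ord0.
under [X in C_on _ _ X]eq_fun do rewrite big_ord_recl.
by apply: C_onD => //; apply: IH.
Qed.

Lemma C_onM r (g h : V -> R) : open U ->
  C_on r U g -> C_on r U h -> C_on r U (fun z => g z * h z).
Proof.
move=> oU; elim: r g h => [|r IH] g h.
  by move=> cg ch z Uz; apply: cvgM; [exact: cg|exact: ch].
move=> Cg Ch; have [dg Dg] := Cg; have [dh Dh] := Ch; split => [z Uz|v].
  by apply: differentiableM; [exact: dg|exact: dh].
(* The product rule multiplies a function of order [r.+1] by a derivative of order [r], so [C_onS]
   first lowers the undifferentiated factor. *)
apply: C_on_ext (C_onD oU (IH _ _ (C_onS Cg) (Dh v)) (IH _ _ (C_onS Ch) (Dg v)))
  => // z Uz.
by rewrite -[RHS]/('D_v (g * h) z) deriveM//; apply: diff_derivable;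
  [exact: dg|exact: dh].
Qed.

Lemma C_on_comp_linear (W X : normedModType R) r (g : V -> W) (L : W -> X) :
    open U -> linear L -> continuous L ->
  C_on r U g -> C_on r U (fun z => L (g z)).
Proof.
move=> oU linL contL; elim: r g => [|r IH] g.
  by move=> cg z Uz; apply: continuous_comp; [exact: cg|exact: contL].
move=> [dg Dg]; split => [z Uz|v].
  by apply: differentiable_comp; [exact: dg|exact: differentiable_linear].
apply: C_on_ext (IH _ (Dg v)) => // z Uz.
by rewrite (derive_comp_linear v linL contL (dg z Uz)).
Qed.

Lemma C_on_coord N r (g : V -> 'rV[R]_N) i : open U ->
  C_on r U g -> C_on r U (fun z => g z 0 i).
Proof.
move=> oU; apply: (C_on_comp_linear (L := fun M : 'rV[R]_N => M 0 i)) => //.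
  by move=> c x y; rewrite !mxE.
exact: coord_continuous.
Qed.

(** A row vector is the sum of its coordinates times basis vectors, and each summand is a linear
    image of one coordinate. *)
Lemma C_on_rV N r (g : V -> 'rV[R]_N) : open U ->
  (forall i, C_on r U (fun z => g z 0 i)) -> C_on r U g.
Proof.
move=> oU Cg.
rewrite [X in C_on _ _ X](_ : _ = fun z => \sum_i g z 0 i *: delta_mx 0 i).
  apply: C_on_sum => // i.
  apply: (C_on_comp_linear (L := fun c : R => c *: delta_mx 0 i)) => //.
    by move=> c x y; rewrite scalerDl scalerA.
  exact: scalel_continuous.
by apply/funext => z; exact: row_sum_delta.
Qed.

End C_on.

(** By the chain rule, differentiating along [v] replaces [g] by its derivative along [L v], still
    precomposed with [L]. The direction is constant because [L] is linear, so the induction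
    hypothesis applies. *)
Lemma C_on_precomp_linear (R : realType) (V W X : normedModType R) r
    (U : set W) (g : W -> X) (L : V -> W) :
    open U -> linear L -> continuous L ->
  C_on r U g -> C_on r (L @^-1` U) (fun z => g (L z)).
Proof.
move=> oU linL contL; elim: r g => [|r IH] g.
  by move=> cg z Uz; apply: continuous_comp; [exact: contL|exact: cg].
move=> [dg Dg]; split => [z Uz|v].
  by apply: differentiable_comp; [exact: differentiable_linear|exact: dg].
have oLU : open (L @^-1` U) by apply: open_comp => // z _; exact: contL.
apply: C_on_ext (IH _ (Dg (L v))) => // z Uz.
by rewrite (derive_precomp_linear v linL contL (dg _ Uz)).
Qed.


(** * Partial Jacobians as directional derivatives on the product space *)

Section Jacobian.
Context {R : realType} {n m k : nat}.
Variable g : 'rV[R]_n -> 'rV[R]_m -> 'rV[R]_k.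

Lemma differentiable_fst_section x y :
  differentiable (fun z => g z.1 z.2) (x, y) -> differentiable (g ^~ y) x.
Proof.
move=> dg; apply: (differentiable_comp (f := fun x => (x, y))) dg.
exact: differentiable_pair.
Qed.

Lemma differentiable_snd_section x y :
  differentiable (fun z => g z.1 z.2) (x, y) -> differentiable (g x) y.
Proof.
move=> dg; apply: (differentiable_comp (f := fun y => (x, y))) dg.
exact: differentiable_pair.
Qed.

(** With [y] fixed, the difference quotients of the section are those of the joint map along
    [(delta_mx 0 j, 0)]. This makes the entries of the Jacobian accessible to [C_on], which speaks
    of directional derivatives on the product. *)
Lemma jac1E x y i j : differentiable (fun z => g z.1 z.2) (x, y) ->
  jac1 g x y i j = 'D_(delta_mx 0 j, 0) (fun z => g z.1 z.2) (x, y) 0 i.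
Proof.
move=> /differentiable_fst_section dg.
have <- : 'D_(delta_mx 0 j) (g ^~ y) x =
    'D_(delta_mx 0 j, 0) (fun z => g z.1 z.2) (x, y).
  rewrite /derive /=.
  by under [in RHS]eq_fun do rewrite scaler0 add0r.
by rewrite deriveEjacobian// -rowE !mxE.
Qed.

Lemma jac2E x y i j : differentiable (fun z => g z.1 z.2) (x, y) ->
  jac2 g x y i j = 'D_(0, delta_mx 0 j) (fun z => g z.1 z.2) (x, y) 0 i.
Proof.
move=> /differentiable_snd_section dg.
have <- : 'D_(delta_mx 0 j) (g x) y =
    'D_(0, delta_mx 0 j) (fun z => g z.1 z.2) (x, y).
  rewrite /derive /=.
  by under [in RHS]eq_fun do rewrite scaler0 add0r.
by rewrite deriveEjacobian// -rowE !mxE.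
Qed.

Lemma jac2_derive_coord x y i j : differentiable (g x) y ->
  jac2 g x y i j = 'D_(delta_mx 0 j) (fun y' => g x y' 0 i) y.
Proof.
move=> dg.
rewrite (derive_comp_linear (L := fun M : 'rV[R]_k => M 0 i))//.
- by rewrite deriveEjacobian// -rowE !mxE.
- by move=> c u v; rewrite !mxE.
- exact: coord_continuous.
Qed.

Lemma C_on_jac1 r U i j : open U -> C_on r.+1 U (fun z => g z.1 z.2) ->
  C_on r U (fun z => jac1 g z.1 z.2 i j).
Proof.
move=> oU [dg Dg].
apply: C_on_ext (C_on_coord i oU (Dg (delta_mx 0 j, 0))) => //.
by move=> [x y] Uxy; rewrite jac1E//; exact: dg.
Qed.

Lemma C_on_jac2 r U i j : open U -> C_on r.+1 U (fun z => g z.1 z.2) ->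
  C_on r U (fun z => jac2 g z.1 z.2 i j).
Proof.
move=> oU [dg Dg].
apply: C_on_ext (C_on_coord i oU (Dg (0, delta_mx 0 j))) => //.
by move=> [x y] Uxy; rewrite jac2E//; exact: dg.
Qed.

End Jacobian.

(** The difference quotient is constantly [c] for nonzero [h], so the limit exists without any
    differentiability assumption. This serves the directions of the multipliers. *)
Lemma derive_affine_along (R : realType) (V W : normedModType R) (g : V -> W)
    a v c : (forall h : R, g (h *: v + a) - g a = h *: c) -> 'D_v g a = c.
Proof.
move=> gE; apply: cvg_lim => //.
have gc : \forall h \near (0 : R)^', c = h^-1 *: (g (h *: v + a) - g a).
  near=> h; rewrite gE scalerA mulVf ?scale1r//.
  by near: h; exact: nbhs_dnbhs_neq.
exact: cvg_trans (near_eq_cvg gc) (cvg_cst c).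
Unshelve. all: by end_near. Qed.

(** * Basis vectors and continuity in block coordinates *)

Lemma lsubmx_delta_lshift (R : nzRingType) m k (j : 'I_m) :
  lsubmx (delta_mx 0 (lshift k j)) = delta_mx 0 j :> 'rV[R]_m.
Proof. by apply/rowP => i; rewrite !mxE (inj_eq (@lshift_inj _ _)). Qed.

Lemma lsubmx_delta_rshift (R : nzRingType) m k (j : 'I_k) :
  lsubmx (delta_mx 0 (rshift m j)) = 0 :> 'rV[R]_m.
Proof. by apply/rowP => i; rewrite !mxE eq_lrshift andbF. Qed.

Lemma rsubmx_delta_rshift (R : nzRingType) m k (j : 'I_k) :
  rsubmx (delta_mx 0 (rshift m j)) = delta_mx 0 j :> 'rV[R]_k.
Proof. by apply/rowP => i; rewrite !mxE (inj_eq (@rshift_inj _ _)). Qed.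

Lemma continuous_comp_fst (R : realType) (V V' W : normedModType R)
    (g : V -> W) : continuous g -> continuous (fun z : V * V' => g z.1).
Proof.
by move=> cg z; apply: continuous_comp; [exact: cvg_fst|exact: cg].
Qed.

Lemma continuous_comp_snd (R : realType) (V V' W : normedModType R)
    (g : V' -> W) : continuous g -> continuous (fun z : V * V' => g z.2).
Proof.
by move=> cg z; apply: continuous_comp; [exact: cvg_snd|exact: cg].
Qed.

Lemma continuous_map_pair (R : realType) (V V' W W' : normedModType R)
    (g : V -> W) (h : V' -> W') : continuous g -> continuous h ->
  continuous (fun z : V * V' => (g z.1, h z.2)).
Proof.
move=> cg ch z; apply: cvg_pair => /=.
  exact: continuous_comp_fst.
exact: continuous_comp_snd.
Qed.

(** * Smoothness of the adjoint system and the Jacobian of its constraints *)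

Section Adjoint.
Context {R : realType} {n m k : nat}.
Variables (U : set ('rV[R]_n * 'rV[R]_m)).
Variables (f : 'rV[R]_n -> 'rV[R]_m -> 'rV[R]_n).
Variables (phi : 'rV[R]_n -> 'rV[R]_m -> 'rV[R]_k).

(** The projection from (q, p, u, lambda) to (q, u); [adjoint_dom U] is the preimage of [U] under
    it. *)
Let base (Z : 'rV[R]_(n + n) * 'rV[R]_(m + k)) := (lsubmx Z.1, lsubmx Z.2).

Let base_linear : linear base.
Proof. by move=> c x y; rewrite /base /= !linearP. Qed.

Let base_continuous : continuous base.
Proof.
apply: (@continuous_map_pair R 'rV[R]_(n + n) 'rV[R]_(m + k) 'rV[R]_n 'rV[R]_m
  lsubmx lsubmx); exact: continuous_lsubmx.
Qed.

Lemma open_adjoint_dom : open U -> open (adjoint_dom (k := k) U).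
Proof.
by move=> oU; apply: (open_comp (f := base)) => // Z _; exact: base_continuous.
Qed.

Lemma C_on_base (W : normedModType R) r (g : 'rV[R]_n * 'rV[R]_m -> W) :
  open U -> C_on r U g -> C_on r (adjoint_dom U) (fun Z => g (base Z)).
Proof. by move=> oU; exact: C_on_precomp_linear. Qed.

Lemma C_on_momentum r i :
  C_on r (adjoint_dom (k := k) U) (fun Z => rsubmx Z.1 0 i).
Proof.
apply: C_on_linear => [c x y|]; first by rewrite /= !linearP/= !mxE.
apply: (@continuous_comp_fst R 'rV[R]_(n + n) 'rV[R]_(m + k) R
  (fun M => rsubmx M 0 i)).
by under eq_fun do rewrite mxE; exact: coord_continuous.
Qed.

Lemma C_on_multiplier r i :
  C_on r (adjoint_dom (k := k) U) (fun Z => rsubmx Z.2 0 i).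
Proof.
apply: C_on_linear => [c x y|]; first by rewrite /= !linearP/= !mxE.
apply: (@continuous_comp_snd R 'rV[R]_(n + n) 'rV[R]_(m + k) R
  (fun M => rsubmx M 0 i)).
by under eq_fun do rewrite mxE; exact: coord_continuous.
Qed.

Hypotheses (oU : open U) (smooth_f : smooth_on U (fun z => f z.1 z.2)).
Hypothesis smooth_phi : smooth_on U (fun z => phi z.1 z.2).

Let oA := open_adjoint_dom oU.

Lemma smooth_adjoint_F : smooth_on (adjoint_dom U)
  (fun Z => adjoint_F f phi Z.1 Z.2).
Proof.
move=> r; apply: C_on_rV => // i; case: (split_ordP i) => j ->.
  under [X in C_on _ _ X]eq_fun do rewrite row_mxEl.
  exact: (C_on_base oU (C_on_coord _ oU (smooth_f r))).
(* Factoring out the sign leaves a sum of products of a linear coordinate with a Jacobian entry.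
   Each such entry costs one order of smoothness, hence [r.+1] below. *)
under [X in C_on _ _ X]eq_fun do rewrite row_mxEr mxE -opprD.
apply: (C_on_comp_linear (L := -%R)) => //.
- by move=> c x y; rewrite opprD scalerN.
- by move=> x; exact: opp_continuous.
apply: C_onD => //; apply: C_on_sum => // l; apply: C_onM => //.
- exact: C_on_momentum.
- exact: (C_on_base oU (C_on_jac1 _ _ oU (smooth_f r.+1))).
- exact: C_on_multiplier.
- exact: (C_on_base oU (C_on_jac1 _ _ oU (smooth_phi r.+1))).
Qed.

Lemma smooth_adjoint_G : smooth_on (adjoint_dom U)
  (fun Z => adjoint_G f phi Z.1 Z.2).
Proof.
move=> r; apply: C_on_rV => // i; case: (split_ordP i) => j ->.
  under [X in C_on _ _ X]eq_fun do rewrite row_mxEl.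
  exact: (C_on_base oU (C_on_coord _ oU (smooth_phi r))).
under [X in C_on _ _ X]eq_fun do rewrite row_mxEr mxE.
apply: C_onD => //; apply: C_on_sum => // l; apply: C_onM => //.
- exact: C_on_momentum.
- exact: (C_on_base oU (C_on_jac2 _ _ oU (smooth_f r.+1))).
- exact: C_on_multiplier.
- exact: (C_on_base oU (C_on_jac2 _ _ oU (smooth_phi r.+1))).
Qed.

Lemma jac2_adjoint_G X Y : adjoint_dom U (X, Y) ->
  let J := jac2 phi (lsubmx X) (lsubmx Y) in
  exists S, jac2 (adjoint_G f phi) X Y = block_mx J 0 S J^T.
Proof.
move=> UXY J.
have dG : differentiable (adjoint_G f phi X) Y.
  apply: differentiable_snd_section.
  by have [dG _] := smooth_adjoint_G 1; exact: dG.
have dphi : differentiable (phi (lsubmx X)) (lsubmx Y).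
  apply: differentiable_snd_section.
  by have [dphi _] := smooth_phi 1; exact: dphi.
(* The lower left block involves second derivatives of [f] and [phi], but the determinant does not
   see it, so it is named and not computed. *)
exists (dlsubmx (jac2 (adjoint_G f phi) X Y)).
(* The first [k] constraints depend on [Y] only through u. Basis directions in u will give the block
   [J], those in lambda the zero block. *)
have D_phi i v : 'D_v (fun Y' => adjoint_G f phi X Y' 0 (lshift m i)) Y =
    'D_(lsubmx v) (fun u => phi (lsubmx X) u 0 i) (lsubmx Y).
  under eq_fun do rewrite row_mxEl.
  pose g u : R := phi (lsubmx X) u 0 i.
  have dg : differentiable g (lsubmx Y).
    exact: (@differentiable_comp R _ _ _ (phi (lsubmx X))
      (fun M : 'rV[R]_k => M 0 i) _ dphi (differentiable_coord _ _ _)).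
  apply: (derive_precomp_linear v _ _ dg).
    by move=> c x y; rewrite linearP.
  exact: continuous_lsubmx.
rewrite -[LHS]submxK; congr block_mx; apply/matrixP => i j.
- rewrite [LHS]mxE [LHS]mxE.
  by rewrite jac2_derive_coord// D_phi lsubmx_delta_lshift jac2_derive_coord.
- rewrite [LHS]mxE [LHS]mxE [RHS]mxE jac2_derive_coord// D_phi.
  by rewrite lsubmx_delta_rshift derive0.
- rewrite [LHS]mxE [LHS]mxE [RHS]mxE jac2_derive_coord//.
  (* A move along the multiplier [j] keeps u, hence all Jacobians in the constraint, fixed. The
     constraint then changes by exactly [h] times the entry of [J] in row [j] and column [i]. *)
  apply: derive_affine_along => h.
  pose Y' := h *: delta_mx 0 (rshift m j) + Y.
  have GE Z : adjoint_G f phi X Z 0 (rshift k i) =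
      \sum_l rsubmx X 0 l * jac2 f (lsubmx X) (lsubmx Z) l i +
      \sum_A rsubmx Z 0 A * jac2 phi (lsubmx X) (lsubmx Z) A i.
    by rewrite /adjoint_G row_mxEr mxE.
  have uE : lsubmx Y' = lsubmx Y.
    by rewrite linearD linearZ /= lsubmx_delta_rshift scaler0 add0r.
  have lE : rsubmx Y' = h *: delta_mx 0 j + rsubmx Y.
    by rewrite linearD linearZ /= rsubmx_delta_rshift.
  rewrite [X in X - _](GE Y') [X in _ - X](GE Y) uE lE.
  (* The momentum sums cancel, and in the multiplier sums only the term [A = j] differs between [Y']
     and [Y]. *)
  rewrite opprD addrACA subrr add0r -sumrB (bigD1 j)//= big1.
    by rewrite addr0 -mulrBl 3!mxE addrK !mxE !eqxx mulr1.
  move=> A /negbTE Aj.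
  by rewrite -mulrBl 3!mxE addrK mxE Aj andbF mulr0 mul0r.
Qed.

End Adjoint.

Theorem mainTheorem3 (R : realType) (n m k : nat)
    (U : set ('rV[R]_n * 'rV[R]_m))
    (f : 'rV[R]_n -> 'rV[R]_m -> 'rV[R]_n)
    (phi : 'rV[R]_n -> 'rV[R]_m -> 'rV[R]_k) :
  index1 (DAE U f phi) -> index1 (adjoint_dae (DAE U f phi)).
Proof.
move=> [[/= oU smf smphi] [sq]].
(* Replacing [m] by [k] makes the cast in the hypothesis an identity and gives [k + m] and [m + k]
   the same form, so [erefl] can later witness squareness. *)
case: m / sq U f phi oU smf smphi => U f phi oU smf smphi unitJ.
split; first split => /=.
- exact: open_adjoint_dom.
- exact: smooth_adjoint_F.
- exact: smooth_adjoint_G.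
exists erefl => X Y /= UXY; rewrite castmx_id => /(congr1 lsubmx).
(* The left part of the vanishing adjoint constraint is [phi = 0] at (q, u), where the index 1
   hypothesis applies. *)
rewrite row_mxKl linear0 => phi0.
have := unitJ _ _ UXY phi0; rewrite castmx_id => uJ.
have [S ->] := jac2_adjoint_G oU smf smphi UXY.
rewrite unitmxE det_lblock unitrM.
by apply/andP; split; rewrite -unitmxE; [|rewrite unitmx_tr]; exact: uJ.
Qed.
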